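(* Let $(X,d)$ be a (nonempty) complete metric space, let $\psi,\phi:(0,\infty)\to\mathbb{R}$ be functions, and let $w:X\times X\to X$ be a continuous map such that for all $(x,y),(u,v)\in X\times X$ with $d(w(x,y),w(u,v))>0$, $$\psi\big(d(w(x,y),w(u,v))\big)\le\phi\big(\max\{d(x,u),d(y,v)\}\big).$$ Suppose that: (i) $\psi$ and $\phi$ are nondecreasing; (ii) $\phi(t)<\psi(t)$ for every $t>0$; (iii) $\limsup_{t\to\epsilon+}\phi(t)<\psi(\epsilon+)$ for every $\epsilon>0$. Then there exists a unique element $(A^*,B^* )\in\mathcal{H}(X)\times\mathcal{H}(X)$ such that $A^*=w(A^*,B^* )$ and $B^*=w(B^*,A^* )$. Moreover, for any $(A,B)\in\mathcal{H}(X)\times\mathcal{H}(X)$, the sequences $A_n=w^n(A,B)$ and $B_n=w^n(B,A)$ converge in $(\mathcal{H}(X),h_d)$ to $A^*$ and $B^*$ respectively.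
   Context: $\mathcal{H}(X)$ is the set of all nonempty compact subsets of $X$, with the Hausdorff metric $h_d(A,B)=\max\{\max_{x\in A}\min_{y\in B}d(x,y),\ \max_{x\in B}\min_{y\in A}d(x,y)\}$. For $A,B\in\mathcal{H}(X)$, $w(A,B)=\{w(a,b):a\in A,\ b\in B\}$, and the iterates are $w^1(A,B)=w(A,B)$, $w^n(A,B)=w\big(w^{n-1}(A,B),w^{n-1}(B,A)\big)$ for $n\ge2$. $\psi(\epsilon+)$ denotes the right-hand limit of $\psi$ at $\epsilon$. *)

(* Defs.v *)
From HB Require Import structures.
From mathcomp Require Import all_boot all_order all_algebra.
From mathcomp Require Import all_classical all_reals all_analysis.
From mathcomp Require Import lra.

Set Implicit Arguments.
Unset Strict Implicit.
Unset Printing Implicit Defensive.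
Import Order.TTheory GRing.Theory Num.Theory.
Import numFieldNormedType.Exports.

Local Open Scope classical_set_scope.
Local Open Scope ring_scope.

(* The library's complete spaces are pointed, so these are nonempty. *)
#[short(type="completeMetricType")]
HB.structure Definition CompleteMetric (K : numDomainType) :=
  {T of Metric K T & Complete T}.

Section hausdorff_distance.
Context {R : realType} {X : metricType R}.
Implicit Types (x y : X) (A B C : set X).

(* On nonempty compact sets this inf and this sup are a min and a max:
   see [point_dist_min] and [excess_max]. *)
Definition point_dist x B : R := inf [set mdist x y | y in B].

Definition excess A B : R := sup [set point_dist x B | x in A].

Definition hausdorff_dist A B : R := Num.max (excess A B) (excess B A).

Lemma continuous_mdist x : continuous (mdist x : X -> R).
Proof.
move=> y; apply/cvgrPdist_le => e e0.
have : \forall z \near y, mdist y z <= e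
    by exact: (metricType_numDomainType.cvgr_dist_le cvg_id).
apply: filterS => z yz; rewrite ler_norml; apply/andP; split.
  by have := metric_triangle x y z; lra.
by have := metric_triangle x z y; rewrite (metric_sym z y); lra.
Qed.

Lemma point_dist_le x B y : B y -> point_dist x B <= mdist x y.
Proof.
move=> By; apply: ge_inf; last by exists y.
by exists 0 => _ [z _ <-]; exact: mdist_ge0.
Qed.

Lemma point_dist_min x B : B !=set0 -> compact B ->
  exists2 y, B y & point_dist x B = mdist x y.
Proof.
move=> B0 cB.
have [y + ymin] := compact_EVT_min B0 cB
  (continuous_subspaceT (@continuous_mdist x)).
rewrite inE => By; exists y => //; apply/eqP; rewrite eq_le point_dist_le//=.
apply: lb_le_inf; first by exists (mdist x y), y.
by move=> _ [z Bz <-]; apply: ymin; rewrite inE.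
Qed.

Lemma point_dist_lip x x' B : B !=set0 -> compact B ->
  point_dist x B <= mdist x x' + point_dist x' B.
Proof.
move=> B0 cB; have [y By ->] := point_dist_min x' B0 cB.
exact: le_trans (point_dist_le x By) (metric_triangle _ _ _).
Qed.

Lemma continuous_point_dist B : B !=set0 -> compact B ->
  continuous (point_dist^~ B : X -> R).
Proof.
move=> B0 cB y; apply/cvgrPdist_le => e e0.
have : \forall z \near y, mdist y z <= e
    by exact: (metricType_numDomainType.cvgr_dist_le cvg_id).
apply: filterS => z yz; rewrite ler_norml; apply/andP; split.
  by have := point_dist_lip z y B0 cB; rewrite (metric_sym z y); lra.
by have := point_dist_lip y z B0 cB; lra.
Qed.

Lemma excess_max A B : A !=set0 -> compact A -> B !=set0 -> compact B ->
  exists2 x, A x &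
    excess A B = point_dist x B /\
    (forall x', A x' -> point_dist x' B <= excess A B).
Proof.
move=> A0 cA B0 cB.
have [x + xmax] := compact_EVT_max A0 cA
  (continuous_subspaceT (continuous_point_dist B0 cB)).
rewrite inE => Ax.
have xub : ubound [set point_dist z B | z in A] (point_dist x B).
  by move=> _ [z Az <-]; apply: xmax; rewrite inE.
have exE : excess A B = point_dist x B.
  apply/eqP; rewrite eq_le; apply/andP; split.
    by apply: ge_sup => //; exists (point_dist x B), x.
  by apply: ub_le_sup; [exists (point_dist x B) | exists x].
by exists x => //; split=> // x' Ax'; rewrite exE; apply: xub; exists x'.
Qed.

End hausdorff_distance.

Record hyperspace (R : realType) (X : metricType R) := Hyperspace {
  hset :> set X;
  hset_nonempty : hset !=set0;
  hset_compact : compact hset }.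
Arguments hset_compact {R X} h.

Section hyperspace_metric.
Context {R : realType} {X : metricType R}.
Implicit Types A B C : hyperspace X.

Lemma hyperspace_inj A B : A = B :> set X -> A = B.
Proof.
case: A B => [A A0 cA] [B B0 cB] /= AB; subst B.
by congr Hyperspace; exact: Prop_irrelevance.
Qed.

Definition hdist A B : R := hausdorff_dist A B.

Lemma excess_near A B x : hset A x ->
  exists2 y, hset B y & mdist x y <= excess A B.
Proof.
move=> Ax.
have [y By xy] := point_dist_min x (hset_nonempty B) (hset_compact B).
have [_ _ [_ /(_ _ Ax)]] := excess_max (hset_nonempty A) (hset_compact A)
  (hset_nonempty B) (hset_compact B).
by rewrite xy => ?; exists y.
Qed.

Lemma excess_le A B (r : R) :
  (forall x, hset A x -> exists2 y, hset B y & mdist x y <= r) -> excess A B <= r.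
Proof.
move=> h; have [x Ax [-> _]] := excess_max (hset_nonempty A)
  (hset_compact A) (hset_nonempty B) (hset_compact B).
by have [y By] := h x Ax; exact/le_trans/point_dist_le.
Qed.

Lemma hdistxx A : hdist A A = 0.
Proof.
rewrite /hdist /hausdorff_dist maxxx; apply/eqP; rewrite eq_le; apply/andP; split.
  by apply: excess_le => x Ax; exists x => //; rewrite mdistxx.
have [x Ax] := hset_nonempty A.
by have [y _] := excess_near A Ax; exact/le_trans/mdist_ge0.
Qed.

Lemma hdist_sym A B : hdist A B = hdist B A.
Proof. exact: maxC. Qed.

Lemma excess_triangle B A C : excess A C <= excess A B + excess B C.
Proof.
apply: excess_le => x /(excess_near B)[y /(excess_near C)[z Cz yz] xy].
by exists z => //; exact: le_trans (metric_triangle _ y _) (lerD xy yz).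
Qed.

Lemma hdist_triangle B A C : hdist A C <= hdist A B + hdist B C.
Proof.
rewrite /hdist /hausdorff_dist ge_max; apply/andP; split.
  apply: le_trans (excess_triangle B A C) _.
  by apply: lerD; rewrite le_max lexx.
apply: le_trans (excess_triangle B C A) _.
by rewrite addrC; apply: lerD; rewrite le_max lexx orbT.
Qed.

Lemma excess_le0_sub A B : excess A B <= 0 -> A `<=` B.
Proof.
move=> AB x /(excess_near B)[y By xy].
suff -> : x = y by [].
by apply/(@mdist_positivity R)/eqP; rewrite eq_le mdist_ge0 (le_trans xy).
Qed.

Lemma hdist_positivity A B : hdist A B = 0 -> A = B.
Proof.
move=> AB; apply: hyperspace_inj; apply/seteqP.
by split; apply: excess_le0_sub; rewrite -AB le_max lexx ?orbT.
Qed.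

End hyperspace_metric.

HB.instance Definition _ (R : realType) (X : metricType R) :=
  gen_eqMixin (hyperspace X).
HB.instance Definition _ (R : realType) (X : metricType R) :=
  gen_choiceMixin (hyperspace X).
HB.instance Definition _ (R : realType) (X : metricType R) :=
  isMetric.Build R (hyperspace X)
    (@hdistxx R X) (@hdist_positivity R X) (@hdist_sym R X) (@hdist_triangle R X).

Section set_valued_iteration.
Context {R : realType} {X : metricType R}.
Variables (w : X * X -> X) (wc : continuous w).
Implicit Types A B : hyperspace X.

Lemma himage_nonempty A B : [set w (a, b) | a in A & b in B] !=set0.
Proof.
have [a Aa] := hset_nonempty A; have [b Bb] := hset_nonempty B.
by exists (w (a, b)), a => //; exists b.
Qed.

Lemma himage_compact A B : compact [set w (a, b) | a in A & b in B].
Proof.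
rewrite (_ : [set _ | _ in _ & _ in _] = w @` (A `*` B)).
  apply: continuous_compact; first exact: continuous_subspaceT.
  by apply: compact_setX; exact: hset_compact.
apply/seteqP; split=> [_ [a Aa [b Bb <-]]|_ [[a b] [/= Aa Bb] <-]].
  by exists (a, b).
by exists a => //; exists b.
Qed.

Definition himage A B : hyperspace X :=
  Hyperspace (himage_nonempty A B) (himage_compact (A := A) (B := B)).

(* [hiter n A B] is w^n(A, B) for n >= 1; the index 0 is the convention
   w^0(A, B) = A, for which the recursion gives w^1(A, B) = w(A, B). *)
Fixpoint hiter (n : nat) A B : hyperspace X :=
  if n is m.+1 then himage (hiter m A B) (hiter m B A) else A.

End set_valued_iteration.

(* Main.v *)
Require Import Defs.
From mathcomp Require Import all_boot all_order all_algebra.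
From mathcomp Require Import all_classical all_reals all_analysis.
From mathcomp Require Import lra.

Set Implicit Arguments.
Unset Strict Implicit.
Unset Printing Implicit Defensive.
Import Order.TTheory GRing.Theory Num.Theory.
Import numFieldNormedType.Exports.

Local Open Scope classical_set_scope.
Local Open Scope ring_scope.

(** The monotonicity of [psi] and [phi] and the one-sided limit condition turn
    the hypothesis on [w] into a Meir-Keeler condition: for every e > 0 there is
    d > 0 such that max(d(x,u), d(y,v)) < e + d forces d(w(x,y), w(u,v)) <= e;
    moreover d(w(x,y), w(u,v)) < m whenever max(d(x,u), d(y,v)) <= m and m > 0.
    Since the Hausdorff distance of two images w(A,B), w(C,D) is attained, both
    properties pass to T(A,B) = (w(A,B), w(B,A)) on pairs of compact sets with
    the max metric.  For such a T, any two orbits become arbitrarily close and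
    every orbit is Cauchy; as the hyperspace is complete, the orbits converge,
    and they all do so to the unique fixed point of T. *)

(** * Orbits of a Meir-Keeler map *)

Section meir_keeler_iterates.
Context {R : realType} {Z : Type}.
Variables (D : Z -> Z -> R) (T : Z -> Z).
Hypotheses (D_ge0 : forall p q, 0 <= D p q) (Dxx : forall p, D p p = 0).
Hypothesis D_triangle : forall q p r, D p r <= D p q + D q r.
Hypothesis T_lt : forall p q, 0 < D p q -> D (T p) (T q) < D p q.
Hypothesis T_mk : forall e, 0 < e ->
  exists2 d, 0 < d & forall p q, D p q < e + d -> D (T p) (T q) <= e.

(** [T_lt] is silent when [D p q = 0]; there [T_mk] bounds the left side by every positive [e]. *)
Lemma meir_keeler_nonexpansive p q : D (T p) (T q) <= D p q.
Proof.
have := D_ge0 p q; rewrite le_eqVlt => /orP[/eqP D0|/T_lt/ltW//].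
apply/ler_addgt0Pl => e e0; have [d d0 /(_ p q)] := T_mk e0.
by rewrite -D0 addr0; apply; rewrite addr_gt0.
Qed.

Lemma meir_keeler_iter_cvg0 p q e : 0 < e ->
  exists N, forall n, (N <= n)%N -> D (iter n T p) (iter n T q) < e.
Proof.
move=> e0; pose r n := D (iter n T p) (iter n T q).
suff [N rN] : exists N, r N < e.
  exists N => n /subnK <-; apply: le_lt_trans rN; rewrite /r.
  elim: (n - N)%N => [|k IH]; first by rewrite add0n.
  by rewrite addSn; apply: le_trans IH; exact: meir_keeler_nonexpansive.
(* Otherwise the infimum of [r] is positive: [T_mk] there brings some [r n.+1] down to it, and
   [T_lt] pushes [r n.+2] strictly below. *)
apply/not_existsP => re.
have {}re n : e <= r n by rewrite leNgt; exact/negP/re.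
have hr : has_inf (range r).
  by split; [exists (r 0%N), 0%N | exists e => _ [n _ <-]].
have lr n : inf (range r) <= r n by apply: ge_inf; [case: hr | exists n].
have l0 : 0 < inf (range r).
  apply: (lt_le_trans e0); apply: lb_le_inf; first by case: hr.
  by move=> _ [n _ <-].
have [d d0 mk] := T_mk l0.
have [_ [n _ <-] /mk rn] := inf_adherent d0 hr.
have : 0 < r n.+1 by exact: lt_le_trans (lr _).
move=> /T_lt /lt_le_trans /(_ rn).
by rewrite ltNge => /negP; apply; exact: (lr n.+2).
Qed.

Lemma meir_keeler_iter_cauchy p e : 0 < e ->
  exists N, forall n, (N <= n)%N -> D (iter N T p) (iter n T p) <= e.
Proof.
move=> e0; have e20 : 0 < e / 2 by rewrite divr_gt0.
have [d d0 mk] := T_mk e20.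
have m0 : 0 < Num.min d (e / 2) by rewrite lt_min d0.
have [N /(_ _ (leqnn N)) rN] := meir_keeler_iter_cvg0 p (T p) m0.
rewrite -iterSr /= lt_min in rN; case/andP: rN => rNd rNe.
(* [T] maps this ball around [iter N T p] into itself: [T_mk] puts the image within [e / 2] of
   [iter N.+1 T p], and the last step of the orbit is shorter than the minimum. *)
suff H k : D (iter N T p) (iter (k + N) T p) < e / 2 + Num.min d (e / 2).
  exists N => n /subnK <-; apply: le_trans (ltW (H _)) _.
  by rewrite [leRHS]splitr lerD2l ge_min lexx orbT.
elim: k => [|k IH]; first by rewrite add0n Dxx addr_gt0.
apply: le_lt_trans (D_triangle (T (iter N T p)) _ _) _.
rewrite addrC addSn /= ler_ltD ?lt_min ?rNd//.
by apply: mk; apply: lt_le_trans IH _; rewrite lerD2l ge_min lexx.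
Qed.

End meir_keeler_iterates.

(** * Thickenings and the Hausdorff distance *)

Section thickening.
Context {R : realType} {X : metricType R}.

Definition thickening (K : set X) (e : R) : set X :=
  [set x | exists2 y, K y & mdist x y <= e].

Lemma mdist_near (F : set_system X) {FF : Filter F} (x : X) (e : R) :
  F --> x -> 0 < e -> F [set y | mdist x y < e].
Proof. by move=> Fx e0; apply: Fx; rewrite -ballEmdist; exact: nbhsx_ballx. Qed.

Lemma hyperspace_near (A B : hyperspace X) x : hset A x ->
  exists2 y, hset B y & mdist x y <= mdist A B.
Proof.
move=> /(excess_near B)[y By xy]; exists y => //.
by apply: le_trans xy _; rewrite [leRHS]/(hausdorff_dist _ _) le_max lexx.
Qed.

Lemma hyperspace_mdist_le (A B : hyperspace X) (r : R) :
  A `<=` thickening B r -> B `<=` thickening A r -> mdist A B <= r.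
Proof.
move=> AB BA; rewrite [leLHS]/(hausdorff_dist _ _) ge_max.
by rewrite !excess_le.
Qed.

End thickening.

(** * Completeness of the hyperspace *)

Section hyperspace_complete.
Context {R : realType} {X : completeMetricType R}.

(* The traces on [K] of the thickened members of [U] form a filter, which
   clusters at some point of [K]; balls around that point must lie in [U]. *)
Lemma ultra_thickening_cvg (U : set_system X) {UU : UltraFilter U} :
  (forall e, 0 < e -> exists2 K, compact K & U (thickening K e)) -> cvg U.
Proof.
move=> UK; apply: cauchy_cvg; apply/cauchy_exP => e e0.
have e30 : 0 < e / 3 by rewrite divr_gt0.
have [K cK UKe] := UK _ e30.
pose near_in (S : set X) := [set y | K y /\ exists2 x, S x & mdist x y <= e / 3].
have GF : ProperFilter (filter_from U near_in).
  apply: filter_from_proper; last first.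
    move=> S US; have [x [Sx [y Ky xy]]] := filter_ex (filterI US UKe).
    by exists y; split => //; exists x.
  apply: filter_from_filter; first by exists setT; exact: filterT.
  move=> S S' US US'; exists (S `&` S'); first exact: filterI.
  by move=> y [Ky [x [Sx S'x] xy]]; split; split => //; exists x.
have [|y [Ky clGy]] := cK _ GF.
  by exists setT; [exact: filterT | move=> y []].
(* If [U] held the complement of the ball, its trace on [K] would come within [e / 3] of [y], giving
   a point outside the ball at distance less than [e] from [y]. *)
exists y; have [//|/= Uy] := in_ultra_setVsetC (ball y e) UU.
have [||z [[_ [x yx xz]] yz]] := clGy (near_in (~` ball y e)) (ball y (e / 3)).
- by exists (~` ball y e).
- exact: nbhsx_ballx.
exfalso; apply: yx; move: yz; rewrite !ballEmdist /= => yz.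
by have := metric_triangle y z x; rewrite (metric_sym z x); lra.
Qed.

Variable A : nat -> hyperspace X.
Hypothesis A_cauchy : forall e : R, 0 < e ->
  exists N, forall n, (N <= n)%N -> mdist (A N) (A n) <= e.

(** The Kuratowski lower limit: the points whose distance to [A n] tends to 0. *)
Definition hlimit : set X :=
  [set x | forall e, 0 < e -> \forall n \near \oo, thickening (A n) e x].

Lemma hlimit_sub e N : 0 < e ->
  (forall n, (N <= n)%N -> mdist (A N) (A n) <= e) ->
  hlimit `<=` thickening (A N) (2 * e).
Proof.
move=> e0 AN x /(_ e e0) Ax.
have [n [Nn [y Any xy]]] := filter_ex (filterI (nbhs_infty_ge N) Ax).
have [z ANz yz] := hyperspace_near (A N) Any; exists z => //.
have := AN n Nn; have := metric_triangle x y z.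
by rewrite (metric_sym (A n)) in yz; lra.
Qed.

(* Points [y n] of [A n] near [a] have a limit along any ultrafilter, since they
   are eventually close to a compact set; this avoids extracting a
   geometrically convergent subsequence. *)
Lemma hlimit_near e N : 0 < e ->
  (forall n, (N <= n)%N -> mdist (A N) (A n) <= e) ->
  A N `<=` thickening hlimit (2 * e).
Proof.
move=> e0 AN a ANa.
have /choice[y yP] n : exists y, hset (A n) y /\ mdist a y <= mdist (A N) (A n).
  by have [y] := hyperspace_near (A n) ANa; exists y.
have [U [UU yU]] := ultraFilterLemma (fmap_proper_filter y eventually_filter).
have UE M : U [set y n | n in [set n | (M <= n)%N]].
  by apply: yU; exists M => // n /= Mn; exists n.
have /mdist_near Ux : cvg U.
  apply: ultra_thickening_cvg => d d0; have [M AM] := A_cauchy d0.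
  exists (hset (A M)); first exact: hset_compact.
  apply: filterS (UE M) => _ [n Mn <-].
  have [z AMz yz] := hyperspace_near (A M) (yP n).1; exists z => //.
  by apply: le_trans yz _; rewrite metric_sym; exact: AM.
exists (lim U).
  (* One third each for [lim U] to [y m], [A m] to [A M], and [A M] to [A n]. *)
  move=> d d0; have d30 : 0 < d / 3 by rewrite divr_gt0.
  have [M AM] := A_cauchy d30; exists M => // n /= Mn.
  have [_ [[m Mm <-] /= xm]] := filter_ex (filterI (UE M) (Ux _ d30)).
  have [z Anz yz] := hyperspace_near (A n) (yP m).1; exists z => //.
  have := metric_triangle (A m) (A M) (A n); rewrite (metric_sym _ (A M)).
  have := AM m Mm; have := AM n Mn; have := metric_triangle (lim U) (y m) z.
  by lra.
have [_ [[m Nm <-] /= xm]] := filter_ex (filterI (UE N) (Ux _ e0)).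
have := metric_triangle a (y m) (lim U); rewrite (metric_sym (y m)).
by have [_] := yP m; have := AN m Nm; lra.
Qed.

Lemma hlimit_nonempty : hlimit !=set0.
Proof.
have [N AN] := A_cauchy ltr01; have [a ANa] := hset_nonempty (A N).
by have [x Lx _] := hlimit_near ltr01 AN ANa; exists x.
Qed.

(** An ultrafilter on [hlimit] contains thickenings of the compact sets [A N] of every radius, so it
    converges; its limit stays in [hlimit], which is closed. *)
Lemma hlimit_compact : compact hlimit.
Proof.
rewrite compact_ultra => U UU UL.
have Ux : cvg U.
  apply: ultra_thickening_cvg => e e0; have e20 : 0 < e / 2 by rewrite divr_gt0.
  have [N AN] := A_cauchy e20; exists (hset (A N)); first exact: hset_compact.
  have -> : e = 2 * (e / 2) by lra.
  by apply: filterS UL; exact: hlimit_sub.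
exists (lim U); split => // e e0; have e20 : 0 < e / 2 by rewrite divr_gt0.
have [x [/(_ _ e20) Lx /= xU]] := filter_ex (filterI UL (mdist_near Ux e20)).
apply: filterS Lx => n [y Any xy]; exists y => //.
by have := metric_triangle (lim U) x y; lra.
Qed.

Lemma hyperspace_cauchy_cvg : exists L : hyperspace X, A n @[n --> \oo] --> L.
Proof.
exists (Hyperspace hlimit_nonempty hlimit_compact).
apply/(@metricType_numDomainType.cvgrPdist_lt R (hyperspace X)) => e e0.
(* Two quarters go from [hlimit] to [A N], one from [A N] to [A n]; the fourth makes the bound
   strict. *)
have e40 : 0 < e / 4 by rewrite divr_gt0.
have [N AN] := A_cauchy e40; exists N => // n /= Nn.
apply: (@le_lt_trans _ _ (3 * (e / 4))); last by lra.
have ANn := AN n Nn; apply: hyperspace_mdist_le => x.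
  move=> /(hlimit_sub e40 AN)[y ANy xy].
  have [z Anz yz] := hyperspace_near (A n) ANy; exists z => //.
  by have := metric_triangle x y z; lra.
move=> /(hyperspace_near (A N))[y /(hlimit_near e40 AN)[z Lz yz] xy].
exists z => //; rewrite (metric_sym (A n)) in xy.
by have := metric_triangle x y z; lra.
Qed.

End hyperspace_complete.

(** * Lifting [w] to compact sets *)

Section hyperspace_lift.
Context {R : realType} {X : metricType R}.
Variables (w : X * X -> X) (wc : continuous w).

(** The excess is attained at some [w (x, y)], and any [w (u, v)] in the second image bounds it; [u]
    and [v] are chosen near [x] and [y]. *)
Lemma excess_himage (A B C D : hyperspace X) : exists x y u v : X,
  [/\ mdist x u <= mdist A C, mdist y v <= mdist B D &
      excess (himage wc A B) (himage wc C D) <= mdist (w (x, y)) (w (u, v))].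
Proof.
have [_ [x Ax [y By <-]] [-> _]] := excess_max
  (hset_nonempty (himage wc A B)) (hset_compact (himage wc A B))
  (hset_nonempty (himage wc C D)) (hset_compact (himage wc C D)).
have [u Cu xu] := hyperspace_near C Ax; have [v Dv yv] := hyperspace_near D By.
exists x, y, u, v; split => //; apply: point_dist_le.
by exists u => //; exists v.
Qed.

Lemma mdist_himage (A B C D : hyperspace X) : exists x y u v : X,
  [/\ mdist x u <= mdist A C, mdist y v <= mdist B D &
      mdist (himage wc A B) (himage wc C D) <= mdist (w (x, y)) (w (u, v))].
Proof.
have [x [y [u [v [xu yv xyuv]]]]] := excess_himage A B C D.
have [x' [y' [u' [v' [xu' yv' xyuv']]]]] := excess_himage C D A B.
have [le|/ltW le] := leP (excess (himage wc A B) (himage wc C D))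
  (excess (himage wc C D) (himage wc A B)).
  exists x', y', u', v'; rewrite (metric_sym A) (metric_sym B); split => //.
  by rewrite [leLHS]/(hausdorff_dist _ _) ge_max xyuv' (le_trans le).
exists x, y, u, v; split => //.
by rewrite [leLHS]/(hausdorff_dist _ _) ge_max xyuv (le_trans le).
Qed.

Lemma iter_himage n (A B : hyperspace X) :
  iter n (fun P => (himage wc P.1 P.2, himage wc P.2 P.1)) (A, B) =
  (hiter wc n A B, hiter wc n B A).
Proof. by elim: n A B => //= n IH A B; rewrite IH. Qed.

End hyperspace_lift.

(** * From the [psi]-[phi] condition to Meir-Keeler *)

Section psi_phi_contraction.
Context {R : realType} {X : metricType R}.
Variables (psi phi : R -> R) (w : X * X -> X).
Hypothesis hw : forall x y u v : X,
  0 < mdist (w (x, y)) (w (u, v)) ->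
  psi (mdist (w (x, y)) (w (u, v))) <= phi (Num.max (mdist x u) (mdist y v)).
Hypothesis psi_nd : {in `]0, +oo[ &, nondecreasing_fun psi}.
Hypothesis phi_nd : {in `]0, +oo[ &, nondecreasing_fun phi}.
Hypothesis phi_lt_psi : forall t : R, 0 < t -> phi t < psi t.

Lemma psi_le s t : 0 < s -> s <= t -> psi s <= psi t.
Proof.
by move=> s0 st; apply: psi_nd => //; rewrite in_itv /= andbT // (lt_le_trans s0).
Qed.

Lemma phi_le s t : 0 < s -> s <= t -> phi s <= phi t.
Proof.
by move=> s0 st; apply: phi_nd => //; rewrite in_itv /= andbT // (lt_le_trans s0).
Qed.

Lemma psi_phi_le x y u v m : mdist x u <= m -> mdist y v <= m ->
  0 < mdist (w (x, y)) (w (u, v)) ->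
  psi (mdist (w (x, y)) (w (u, v))) <= phi m.
Proof.
move=> xu yv w0; apply: le_trans (hw w0) _; apply: phi_le; last first.
  by rewrite ge_max xu.
(* [phi] is monotone only on positive reals, so the maximum must be positive: otherwise both values
   of [w] coincide. *)
rewrite lt_max !mdist_gt0; apply/orP.
have [xE|] := eqVneq x u; last by left.
have [yE|] := eqVneq y v; last by right.
by move: w0; rewrite xE yE mdistxx ltxx.
Qed.

Lemma psi_phi_lt x y u v m : 0 < m -> mdist x u <= m -> mdist y v <= m ->
  mdist (w (x, y)) (w (u, v)) < m.
Proof.
move=> m0 xu yv; rewrite ltNge; apply/negP => mw.
have := psi_phi_le xu yv (lt_le_trans m0 mw).
by rewrite leNgt => /negP; apply; apply: lt_le_trans (phi_lt_psi m0) (psi_le _ _).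
Qed.

Hypothesis limsup_phi : forall e : R, 0 < e ->
  (limf_esup (EFin \o phi) e^'+ < (lim (psi t @[t --> e^'+]))%:E)%E.

Lemma lim_at_right_psi_le e t : 0 < e -> e < t ->
  lim (psi t @[t --> e^'+]) <= psi t.
Proof.
move=> e0 et; apply: limr_le.
  (* The right-hand limit exists because [psi] is monotone and bounded below by [psi e] there. *)
  apply: nondecreasing_at_right_is_cvgr; near=> b.
    move=> r s; rewrite !in_itv /= => /andP[er _] /andP[es _] rs.
    by apply: psi_le => //; exact: lt_trans er.
  exists (psi e) => _ [r + <-]; rewrite /= in_itv /= => /andP[er _].
  exact: psi_le (ltW er).
near=> r; apply: psi_le; last by near: r; exact: nbhs_right_le.
by apply: (lt_trans e0); near: r; exact: nbhs_right_gt.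
Unshelve. all: by end_near. Qed.

(** The limsup condition yields [d] with [phi] below [psi(e+)] on the interval from [e] to [e + d].
    An image distance above [e] would force [psi(e+) <= phi m] for the maximum [m], which then can
    neither lie in that interval nor, by [psi_phi_lt], be at most [e]. *)
Lemma psi_phi_meir_keeler e : 0 < e -> exists2 d, 0 < d &
  forall x y u v, mdist x u < e + d -> mdist y v < e + d ->
    mdist (w (x, y)) (w (u, v)) <= e.
Proof.
move=> e0; have /ereal_inf_lt[_ [V [d /= d0 dV] <-] Vl] := limsup_phi e0.
exists d => // x y u v xu yv; rewrite leNgt; apply/negP => ew.
pose m := Num.max (mdist x u) (mdist y v).
have xum : mdist x u <= m by rewrite le_max lexx.
have yvm : mdist y v <= m by rewrite le_max lexx orbT.
have mw := psi_phi_le xum yvm (lt_trans e0 ew).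
have [me|em] := leP m e.
  have := psi_phi_lt e0 (le_trans xum me) (le_trans yvm me).
  by rewrite ltNge (ltW ew).
have Vm : V m.
  apply: dV => //=; rewrite distrC ger0_norm ?subr_ge0 1?ltW//.
  by rewrite ltrBlDl gt_max xu.
have : ((phi m)%:E < (lim (psi t @[t --> e^'+]))%:E)%E.
  by apply: le_lt_trans Vl; apply: ereal_sup_ubound; exists m.
rewrite lte_fin ltNge => /negP; apply.
exact: le_trans (lim_at_right_psi_le e0 ew) mw.
Qed.

End psi_phi_contraction.

(** * The attracting fixed pair *)

Theorem theorem5p1 (R : realType) (X : completeMetricType R)
    (psi phi : R -> R) (w : X * X -> X) (wc : continuous w)
    (hw : forall x y u v : X,
      0 < mdist (w (x, y)) (w (u, v)) ->
      psi (mdist (w (x, y)) (w (u, v)))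
        <= phi (Num.max (mdist x u) (mdist y v)))
    (psi_nd : {in `]0, +oo[ &, nondecreasing_fun psi})
    (phi_nd : {in `]0, +oo[ &, nondecreasing_fun phi})
    (phi_lt_psi : forall t : R, 0 < t -> phi t < psi t)
    (limsup_phi : forall e : R, 0 < e ->
      (limf_esup (EFin \o phi) e^'+ < (lim (psi t @[t --> e^'+]))%:E)%E) :
  exists AB : hyperspace X * hyperspace X,
    unique (fun P : hyperspace X * hyperspace X =>
      P.1 = himage wc P.1 P.2 /\ P.2 = himage wc P.2 P.1) AB /\
    (forall A B : hyperspace X,
      hiter wc n A B @[n --> \oo] --> AB.1 /\
      hiter wc n B A @[n --> \oo] --> AB.2).
Proof.
pose H : metricType R := hyperspace X.
pose D (P Q : H * H) : R := Num.max (mdist P.1 Q.1) (mdist P.2 Q.2).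
pose T (P : H * H) : H * H := (himage wc P.1 P.2, himage wc P.2 P.1).
have D1 P Q : mdist P.1 Q.1 <= D P Q by rewrite le_max lexx.
have D2 P Q : mdist P.2 Q.2 <= D P Q by rewrite le_max lexx orbT.
have D_ge0 P Q : 0 <= D P Q by apply: le_trans (D1 P Q); exact: mdist_ge0.
have Dxx P : D P P = 0 by rewrite /D !mdistxx maxxx.
have D_sym P Q : D P Q = D Q P by rewrite /D metric_sym (metric_sym P.2).
have D_triangle Q P S : D P S <= D P Q + D Q S.
  rewrite ge_max; apply/andP; split.
    exact: le_trans (metric_triangle _ Q.1 _) (lerD (D1 _ _) (D1 _ _)).
  exact: le_trans (metric_triangle _ Q.2 _) (lerD (D2 _ _) (D2 _ _)).
have T_le_w P Q : exists x y u v : X,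
    [/\ mdist x u <= D P Q, mdist y v <= D P Q &
        D (T P) (T Q) <= mdist (w (x, y)) (w (u, v))].
  have [x [y [u [v [xu yv le12]]]]] := mdist_himage wc P.1 P.2 Q.1 Q.2.
  have [x' [y' [u' [v' [xu' yv' le21]]]]] := mdist_himage wc P.2 P.1 Q.2 Q.1.
  have [le|/ltW le] := leP (mdist (T P).1 (T Q).1) (mdist (T P).2 (T Q).2).
    exists x', y', u', v'; rewrite (le_trans xu') // (le_trans yv') //.
    by rewrite ge_max le21 (le_trans le).
  exists x, y, u, v; rewrite (le_trans xu) // (le_trans yv) //.
  by rewrite ge_max le12 (le_trans le).
have T_lt P Q : 0 < D P Q -> D (T P) (T Q) < D P Q.
  move=> PQ0; have [x [y [u [v [xu yv le]]]]] := T_le_w P Q.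
  exact: le_lt_trans le (psi_phi_lt hw psi_nd phi_nd phi_lt_psi PQ0 xu yv).
have T_mk e : 0 < e -> exists2 d, 0 < d &
    forall P Q, D P Q < e + d -> D (T P) (T Q) <= e.
  move=> e0; have [d d0 mk] :=
    psi_phi_meir_keeler hw psi_nd phi_nd phi_lt_psi limsup_phi e0.
  exists d => // P Q PQ; have [x [y [u [v [xu yv le]]]]] := T_le_w P Q.
  by apply: le_trans le (mk _ _ _ _ _ _); apply: le_lt_trans PQ.
have iter_cvg0 := meir_keeler_iter_cvg0 D_ge0 T_lt T_mk.
have cauchy := meir_keeler_iter_cauchy D_ge0 Dxx D_triangle T_lt T_mk.
(* Any starting pair would do; a singleton is at hand. *)
have x0 : [set (point : X)] !=set0 by exists point.
pose A0 : H := Hyperspace x0 (@compact_set1 X point).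
pose P0 : H * H := (A0, A0).
have [L1 L1P] : exists L : H, (iter n T P0).1 @[n --> \oo] --> L.
  apply: hyperspace_cauchy_cvg => e e0; have [N NP] := cauchy P0 e e0.
  by exists N => n /NP; exact: le_trans.
have [L2 L2P] : exists L : H, (iter n T P0).2 @[n --> \oo] --> L.
  apply: hyperspace_cauchy_cvg => e e0; have [N NP] := cauchy P0 e e0.
  by exists N => n /NP; exact: le_trans.
have LP e : 0 < e -> \forall n \near \oo, D (L1, L2) (iter n T P0) < e.
  move=> e0.
  have [N1 _ n1] := metricType_numDomainType.cvgr_dist_lt L1P e0.
  have [N2 _ n2] := metricType_numDomainType.cvgr_dist_lt L2P e0.
  exists (maxn N1 N2) => // n; rewrite /= geq_max => /andP[/n1 h1 /n2 h2].
  by rewrite gt_max h1.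
have T_le := meir_keeler_nonexpansive D_ge0 T_lt T_mk.
have D0 P Q : (forall e, 0 < e -> D P Q <= e) -> P = Q.
  move=> PQ; have {}PQ : D P Q <= 0.
    by apply/ler_addgt0Pl => e e0; rewrite addr0; exact: PQ.
  case: P Q PQ => [P1 P2] [Q1 Q2]; rewrite ge_max /= => /andP[h1 h2].
  by congr pair; apply: (@mdist_positivity R); apply/eqP;
    rewrite eq_le mdist_ge0 andbT.
have fixL : T (L1, L2) = (L1, L2).
  apply: D0 => e e0; have e20 : 0 < e / 2 by rewrite divr_gt0.
  have [N _ NP] := LP _ e20.
  have := D_triangle (iter N.+1 T P0) (T (L1, L2)) (L1, L2).
  rewrite (D_sym (iter N.+1 T P0)); have := NP N.+1 (leqnSn N); have := NP N (leqnn N).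
  by have := T_le (L1, L2) (iter N T P0); rewrite /=; lra.
have iterL P : T P = P -> forall n, iter n T P = P.
  by move=> fixP; elim=> //= n ->.
exists (L1, L2); split.
  split; first by case: fixL => L1E L2E; rewrite /= L1E L2E.
  (* Orbits of fixed pairs are constant, yet any two orbits become arbitrarily close. *)
  case=> Q1 Q2 /= [Q1E Q2E]; have fixQ : T (Q1, Q2) = (Q1, Q2).
    by rewrite /T /= -Q1E -Q2E.
  apply: D0 => e e0; have [N /(_ N (leqnn N))] := iter_cvg0 (L1, L2) (Q1, Q2) e e0.
  by rewrite !iterL // => /ltW.
move=> A B; have cvgL e : 0 < e -> \forall n \near \oo,
    D (L1, L2) (hiter wc n A B, hiter wc n B A) < e.
  (* The orbit of [(A, B)] is compared with the constant orbit of the fixed pair. *)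
  move=> e0; have [N NP] := iter_cvg0 (L1, L2) (A, B) e e0.
  by exists N => // n /= /NP; rewrite iterL // iter_himage.
split; apply/(@metricType_numDomainType.cvgrPdist_lt R H) => e e0.
  have [N _ NP] := cvgL e e0; exists N => // n /NP.
  exact: le_lt_trans (D1 _ _).
have [N _ NP] := cvgL e e0; exists N => // n /NP.
exact: le_lt_trans (D2 _ _).
Qed.
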